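(* Let $X$ be a simplicial surface. Then $X$ is a face-transitive surface satisfying $\mathrm{vf}(X)=(1,6)$ if and only if $H:=\lambda_X(\mathrm{Aut}(X))$ is a $(1,6)$-group of the face graph $\mathcal F(X)$ and the cycle double cover $\mathcal C^{(1,6)}(H)$ (for a suitable choice of the data defining it) contains exactly the vertex-defining cycles of $X$.
   Context: A simplicial complex $X$ on a finite non-empty set $P$ is a non-empty family of subsets of $P$ closed under taking subsets; $X_i$ is the set of its elements of cardinality $i+1$; elements of $X_0,X_1,X_2$ are vertices, edges, faces. A simplicial surface is a simplicial complex $X$ such that: all inclusion-maximal elements have cardinality $3$; every edge lies in exactly two faces; and for every vertex $v$ the faces containing $v$ can be arranged in a cyclic sequence $u(v)=(F_1,\dots,F_n)$ (each once), the umbrella of $v$, with $|F_i\cap F_{i+1}|=2$ (subscripts mod $n$). Simplicial surfaces are assumed strongly connected (any two faces joined by a sequence of faces with consecutive ones sharing an edge). $\mathrm{Aut}(X)$ is the automorphism group (permutations of $X_0$ mapping faces to faces). $X$ is face-transitive if $\mathrm{Aut}(X)$ is transitive on $X_2$; then $\mathrm{vf}(X)=(a,s)$ with $a$ the number of $\mathrm{Aut}(X)$-orbits on $X_0$ and $s$ the order of the stabiliser in $\mathrm{Aut}(X)$ of a face. All graphs are finite, simple, undirected, connected; their elements are called nodes and arcs. The face graph $\mathcal F(X)$ has node set $X_2$, two faces being joined by an arc iff they share an edge; it is cubic. $\lambda_X:\mathrm{Aut}(X)\to\mathrm{Aut}(\mathcal F(X))$ is the injective homomorphism sending an automorphism to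 the permutation it induces on $X_2$. Each umbrella $u(v)$ is a cycle in $\mathcal F(X)$, called a vertex-defining cycle of $X$. Cycles are considered up to rotation and reversal; for a subgroup $H$ of the automorphism group of a graph and a cycle $C$, $C^H$ denotes the $H$-orbit of $C$ under the induced action on cycles. A cycle double cover of a cubic graph is a set of cycles such that every arc lies in exactly two of them. It is vertex-faithful if all its cycles are chordless and any two distinct cycles share at most one arc. $\alpha$-cycles: let $\mathcal G=(V,E)$ be a cubic node-transitive graph (i.e. $\mathrm{Aut}(\mathcal G)$ is transitive on $V$), $F_1,\dots,F_n\in V$ with $\{F_i,F_{i+1}\}\in E$ for $1\le i\le n-1$, and $\sigma\in\mathrm{Aut}(\mathcal G)$ of order $\ell$ with $\sigma(F_1)=F_n$. Put $\Sigma=\{\sigma^i(F_j): 0\le i\le \ell-1,\ 1\le j\le n-1\}$. If $|\Sigma|=(n-1)\ell$, then $\alpha(\sigma,F_1,\dots,F_n)$ is the cycle $(\sigma(F_1),\dots,\sigma(F_{n-1}),\dots,\sigma^\ell(F_1),\dots,\sigma^\ell(F_{n-1}))$; otherwise it is the empty cycle. In particular $\alpha(\sigma,F_1,F_2)=(\sigma(F_1),\sigma^2(F_1),\dots,\sigma^\ell(F_1))$ when these nodes are distinct. A subgroup $H\le\mathrm{Aut}(\mathcal G)$ is a $(1,6)$-group of $\mathcal G$ if: (1) $H$ acts transitively on $V$ with $|H|=6|V|$; (2) there are $F_1,F_2\in V$ with $\{F_1,F_2\}\in E$ and $\sigma\in H$ with $\sigma(F_1)=F_2$ such that $\alpha(\sigma,F_1,F_2)^H$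 is a vertex-faithful cycle double cover of $\mathcal G$. This cover is denoted $\mathcal C^{(1,6)}(H)$. *)

(* Defs.v *)
From mathcomp Require Import all_boot all_fingroup.

Set Implicit Arguments.
Unset Strict Implicit.
Unset Printing Implicit Defensive.

Import GroupScope.

(** A finite simple graph is an adjacency relation [e : rel T] on the finite
    type [T] of its nodes; the arc joining [x] and [y] is the set [[set x; y]]. *)

Section Graphs.

Variables (T : finType) (e : rel T).

Definition arcs : {set {set T}} := [set [set p.1; p.2] | p in [pred p | e p.1 p.2]].

Definition connected_graph := forall x y : T, connect e x y.

Definition cubic_graph :=
  [/\ irreflexive e, symmetric e, connected_graph
    & forall x, #|[set y | e x y]| = 3].

Definition graph_aut : {set {perm T}} :=
  [set s : {perm T} | [forall x, forall y, e (s x) (s y) == e x y]].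

Lemma graph_autP (s : {perm T}) :
  reflect (forall x y, e (s x) (s y) = e x y) (s \in graph_aut).
Proof.
rewrite inE; apply: (iffP forallP) => [h x y | h x].
  by have /forallP/(_ y)/eqP := h x.
by apply/forallP=> y; apply/eqP.
Qed.

Lemma graph_aut_group_set : group_set graph_aut.
Proof.
apply/group_setP; split=> [|s t /graph_autP hs /graph_autP ht];
  by apply/graph_autP=> x y; rewrite ?perm1 ?permM ?ht ?hs.
Qed.
Canonical graph_aut_group := Group graph_aut_group_set.

Definition node_transitive := [transitive graph_aut, on [set: T] | 'P].

(** A cycle is written as a sequence of nodes; [same_cycle] identifies two
    sequences up to rotation and reversal.  A set of cycles is a predicate on
    sequences, and its members are always counted and compared modulo
    [same_cycle]. *)

Definition same_cycle (c d : seq T) :=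
  exists i, d = rot i c \/ d = rot i (rev c).

Definition graph_cycle (c : seq T) :=
  [&& 2 < size c, uniq c & path.cycle e c].

Definition cycle_arcs (c : seq T) : {set {set T}} :=
  [set [set x; next c x] | x in c].

Definition chordless (c : seq T) :=
  forall x y, x \in c -> y \in c -> e x y -> [set x; y] \in cycle_arcs c.

Definition cycle_double_cover (C : seq T -> Prop) :=
  (forall c, C c -> graph_cycle c) /\
  (forall a, a \in arcs -> exists c d,
     [/\ C c /\ a \in cycle_arcs c, C d /\ a \in cycle_arcs d, ~ same_cycle c d
       & forall b, C b -> a \in cycle_arcs b -> same_cycle c b \/ same_cycle d b]).

Definition vertex_faithful (C : seq T -> Prop) :=
  (forall c, C c -> chordless c) /\
  (forall c d, C c -> C d -> ~ same_cycle c d ->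
     #|cycle_arcs c :&: cycle_arcs d| <= 1).

Definition cycle_orbit (H : {set {perm T}}) (c : seq T) : seq T -> Prop :=
  fun d => exists2 h : {perm T}, h \in H & same_cycle [seq h x | x <- c] d.

(** [alpha sigma [:: F_1; ...; F_n]]; the empty cycle is [[::]]. *)

Definition alpha (sigma : {perm T}) (s : seq T) : seq T :=
  let l := #[sigma] in
  let t := take (size s).-1 s in
  let Sigma := [set (sigma ^+ nat_of_ord i) F | i : 'I_l, F : T in t] in
  if #|Sigma| == ((size s).-1 * l)%N
  then flatten [seq [seq (sigma ^+ i) F | F <- t] | i <- iota 1 l]
  else [::].

Definition cover16 (H : {set {perm T}}) (sigma : {perm T}) (F1 F2 : T) :
    seq T -> Prop :=
  cycle_orbit H (alpha sigma [:: F1; F2]).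

Definition data16 (H : {set {perm T}}) (sigma : {perm T}) (F1 F2 : T) :=
  [/\ e F1 F2, sigma \in H, sigma F1 = F2,
      cycle_double_cover (cover16 H sigma F1 F2)
    & vertex_faithful (cover16 H sigma F1 F2)].

Definition is_group16 (H : {group {perm T}}) :=
  [/\ cubic_graph /\ node_transitive,
      H \subset graph_aut,
      [transitive H, on [set: T] | 'P] /\ #|H| = (6 * #|T|)%N
    & exists sigma F1 F2, data16 H sigma F1 F2].

End Graphs.


Section Surfaces.

Variables (P : finType) (X : {set {set P}}).

Definition simplicial_complex :=
  [/\ 0 < #|P|, X != set0
    & forall s t : {set P}, t \in X -> s \subset t -> s \in X].

Definition simplices (i : nat) : {set {set P}} := [set s in X | #|s| == i.+1].

(** Vertices as points of [P] rather than as singletons. *)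
Definition vertices : {set P} := [set v | [set v] \in simplices 0].

Definition face : finType := {F : {set P} | F \in simplices 2}.

Definition face_adj : rel face :=
  fun F G => (F != G) &&
    [exists E in simplices 1, (E \subset val F) && (E \subset val G)].

Definition umbrella (v : P) (c : seq {set P}) :=
  [/\ uniq c, (forall F, (F \in c) = (F \in simplices 2) && (v \in F))
    & path.cycle (fun F G => #|F :&: G| == 2) c].

Definition simplicial_surface :=
  [/\ simplicial_complex,
      (forall s, maxset [pred t | t \in X] s -> #|s| = 3),
      (forall E, E \in simplices 1 ->
         #|[set F in simplices 2 | E \subset F]| = 2),
      (forall v, v \in vertices -> exists c, umbrella v c)
    & connected_graph face_adj].

Definition vertex_defining_cycle (c : seq face) :=
  exists2 v, v \in vertices & umbrella v [seq val F | F <- c].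

(** Permutations of the vertex set are permutations of [P] that fix every
    other point. *)
Definition surface_aut : {set {perm P}} :=
  [set g : {perm P} | perm_on vertices g &
     [forall F in simplices 2, (g @: F) \in simplices 2]].

Lemma surface_autP (g : {perm P}) :
  reflect (perm_on vertices g /\
           forall F : {set P}, F \in simplices 2 -> g @: F \in simplices 2)
          (g \in surface_aut).
Proof.
rewrite inE; apply: (iffP andP) => -[h1 h2]; split=> //.
  by move=> F hF; have /forallP/(_ F)/implyP := h2; apply.
by apply/forallP=> F; apply/implyP/h2.
Qed.

Lemma surface_aut_group_set : group_set surface_aut.
Proof.
apply/group_setP; split=> [|g h /surface_autP[ong hg] /surface_autP[onh hh]].
  apply/surface_autP; split; first exact: perm_on1.
  move=> F; suff -> : (1 : {perm P}) @: F = F by [].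
  by rewrite (eq_imset _ (@perm1 P)) imset_id.
apply/surface_autP; split; first exact: perm_onM.
move=> F hF; rewrite (eq_imset _ (@permM _ g h)) imset_comp.
exact/hh/hg.
Qed.
Canonical surface_aut_group := Group surface_aut_group_set.

Definition face_transitive :=
  [transitive surface_aut, on simplices 2 | 'P^*].

Definition vf_is (a s : nat) :=
  #|orbit 'P surface_aut @: vertices| = a /\
  (forall F, F \in simplices 2 -> #|'C_surface_aut[F | 'P^*]| = s).

(** [surface_aut] acts on faces by direct image; [lambda] is the resulting
    permutation representation. *)
Definition face_act := (('P^* : {action {perm P} &-> {set P}})^? : action _ face)%act.

Lemma surface_aut_dom : surface_aut \subset subact_dom (mem (simplices 2)) 'P^*.
Proof.
apply/subsetP=> g /surface_autP[_ hg].
rewrite 2!inE; apply/andP; split; first by rewrite ?inE.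
by apply/subsetP=> F; rewrite !inE => hF; have := hg F; rewrite !inE; apply.
Qed.

Definition lambda : {perm P} -> {perm face} := actperm face_act.

Lemma lambdaE (g : {perm P}) (F : face) :
  g \in surface_aut -> val (lambda g F) = g @: val F.
Proof.
move=> hg; rewrite /lambda actpermE /face_act /= val_subact.
by rewrite (subsetP surface_aut_dom).
Qed.

Definition lambda_image : {group {perm face}} :=
  (actperm face_act @* surface_aut)%G.

Lemma lambda_imageE : lambda_image = lambda @: surface_aut :> {set _}.
Proof. by rewrite /= /morphim (setIidPr surface_aut_dom). Qed.

End Surfaces.

(* Main.v *)
(* For every simplicial surface the umbrellas form a vertex-faithful cycle
   double cover of the face graph, and each of them is chordless; hence a walk
   in an umbrella that never turns back goes around it, and an umbrella is
   determined by its vertex up to rotation and reversal.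
   An automorphism fixing a face pointwise is trivial, so a face stabiliser of
   order 6 induces all permutations of the face, and a face-transitive surface
   with vf = (1,6) is flag-transitive.  An automorphism that moves one face of
   an umbrella to the next one, fixing the central vertex, rotates the whole
   umbrella by one step, and by rigidity its order is the length of the umbrella:
   this is the alpha-cycle.  Conversely, the order of a face stabiliser is read
   off |H| = 6|V| since lambda is injective, and vertex-transitivity holds since
   the umbrellas form a single H-orbit. *)

Require Import Defs.
From mathcomp Require Import all_boot all_fingroup cyclic.

Set Implicit Arguments.
Unset Strict Implicit.
Unset Printing Implicit Defensive.
Import GroupScope.

(** * Chordless cycles *)

Section CyclicSequences.
Variable T : finType.
Implicit Types (c d : seq T) (x y : T).

(** Turns positions in a cycle into iterates of [next c] from any chosen node, so that cycles can be
    compared through their successor functions. *)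
Lemma traject_next c x : uniq c -> x \in c ->
  exists i, rot i c = traject (next c) x (size c).
Proof.
move=> Uc /rot_to[i c' def_c]; exists i.
have := cycle_next Uc; rewrite -(rot_cycle i) def_c /= -cats1 cat_path.
case/andP=> /fpathP[m def_c'] _.
by rewrite -(size_rot i c) def_c /= {2}def_c' size_traject {1}def_c'.
Qed.

Lemma iter_next_inj c x i j : uniq c -> x \in c -> i < size c -> j < size c ->
  iter i (next c) x = iter j (next c) x -> i = j.
Proof.
move=> Uc xc ltic ltjc; have [k defc] := traject_next Uc xc.
have: uniq (traject (next c) x (size c)) by rewrite -defc rot_uniq.
move=> U eq_ij; apply/eqP; rewrite -(nth_uniq x _ _ U) ?size_traject //.
by rewrite !nth_traject // eq_ij.
Qed.

Lemma iter_next_mem c x i : x \in c -> iter i (next c) x \in c.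
Proof. by move=> xc; elim: i => //= i IH; rewrite mem_next. Qed.

Lemma iter_next_size c x : uniq c -> x \in c -> iter (size c) (next c) x = x.
Proof.
move=> Uc xc; have [k defc] := traject_next Uc xc.
have := cycle_next Uc; rewrite -(rot_cycle k) defc.
case: (size c) => // n; rewrite trajectS /= rcons_path last_traject.
by case/andP=> _ /eqP.
Qed.

Lemma next_next_neq c x : 2 < size c -> uniq c -> x \in c ->
  next c (next c x) != x.
Proof.
move=> c2 Uc xc; apply/eqP=> eqx.
by have /(_ isT) := @iter_next_inj c x 2 0 Uc xc c2 (leq_trans _ c2) eqx.
Qed.

Lemma next_neq_prev c x : 2 < size c -> uniq c -> x \in c ->
  next c x != prev c x.
Proof.
move=> c2 Uc xc; apply: contraNneq (next_next_neq c2 Uc xc) => ->.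
by rewrite next_prev.
Qed.

Lemma same_cycle_mem c d : same_cycle c d -> c =i d.
Proof. by case=> i [] -> x; rewrite mem_rot ?mem_rev. Qed.

Lemma next_arc c x : x \in c -> [set x; next c x] \in cycle_arcs c.
Proof. by move=> xc; apply/imsetP; exists x. Qed.

Lemma prev_arc c x : uniq c -> x \in c -> [set x; prev c x] \in cycle_arcs c.
Proof.
move=> Uc xc; have := @next_arc c (prev c x).
by rewrite mem_prev next_prev // setUC; apply.
Qed.

Lemma cycle_arcs_mem c a x : a \in cycle_arcs c -> x \in a -> x \in c.
Proof.
by case/imsetP=> y yc -> /set2P[] ->; rewrite ?mem_next.
Qed.

Variable e : rel T.
Hypothesis e_sym : symmetric e.

Lemma same_cycle_graph_cycle c d :
  same_cycle c d -> graph_cycle e c -> graph_cycle e d.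
Proof.
move=> cd /and3P[c2 Uc Cc].
case: cd => i [] ->; apply/and3P; split;
  rewrite ?size_rot ?size_rev ?rot_uniq ?rev_uniq ?rot_cycle ?rev_cycle //.
by rewrite (eq_cycle (e' := e)).
Qed.

Lemma chordless_next c x y : graph_cycle e c -> chordless e c ->
  x \in c -> y \in c -> e x y -> y = next c x \/ y = prev c x.
Proof.
move=> /and3P[c2 Uc _] chc xc yc exy.
have /imsetP[z zc /setP eqz] := chc _ _ xc yc exy.
have xz : x \in [set z; next c z] by rewrite -eqz !inE eqxx.
have yz : y \in [set z; next c z] by rewrite -eqz !inE eqxx orbT.
have nz : next c z \in [set x; y] by rewrite eqz !inE eqxx orbT.
have zz : z \in [set x; y] by rewrite eqz !inE eqxx.
move: xz yz nz zz; rewrite !inE => /orP[]/eqP-> /orP[]/eqP->; rewrite ?orbb.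
- by move=> /eqP ->; left.
- by left.
- by right; rewrite prev_next.
- by move=> _ /eqP zn; left; rewrite -zn.
Qed.

(* A walk inside a chordless cycle that never turns back follows the cycle. *)
Lemma iter_chordless (f : T -> T) c x : graph_cycle e c -> chordless e c ->
    x \in c -> f x = next c x ->
    (forall i, iter i f x \in c) ->
    (forall i, e (iter i f x) (iter i.+1 f x)) ->
    (forall i, iter i.+2 f x != iter i f x) ->
  forall i, iter i f x = iter i (next c) x.
Proof.
move=> gc chc xc fx fc ef nf i.
(* Two consecutive agreements are carried along: excluding the backward step requires knowing the
   previous node. *)
suff [] : iter i f x = iter i (next c) x /\ iter i.+1 f x = iter i.+1 (next c) x by [].
elim: i => // i [IH1 IH2]; split=> //.
have [//| eqp] := chordless_next gc chc (fc _) (fc _) (ef i.+1).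
  by rewrite IH2.
case/and3P: gc => _ Uc _.
by case/eqP: (nf i); rewrite eqp IH2 /= prev_next.
Qed.

(** The cycle [d] is itself a walk inside [c] that never turns back, so [iter_chordless] makes it go
    around [c]. Its first step is along [c] or along [rev c]; [main] treats both. *)
Lemma chordless_same_cycle c d : graph_cycle e c -> chordless e c ->
  graph_cycle e d -> c =i d -> same_cycle c d.
Proof.
move=> gc chc gd eqcd; have /and3P[d2 Ud Cd] := gd.
have [x xd] : exists x, x \in d.
  by case: d d2 {Ud Cd gd eqcd} => // x d _; exists x; rewrite mem_head.
have main c' : graph_cycle e c' -> chordless e c' -> c' =i d -> next d x = next c' x ->
    exists i, d = rot i c'.
  move=> gc' chc' eqc' nx; have /and3P[c2 Uc _] := gc'.
  have xc: x \in c' by rewrite eqc'.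
  have eqs : size c' = size d.
    by apply: perm_size; apply: uniq_perm.
  have [j defd] := traject_next Ud xd; have [i defc] := traject_next Uc xc.
  have eqt : rot i c' = rot j d.
    rewrite defc defd eqs; apply/esym/(@eq_from_nth _ x);
      rewrite !size_traject // => k ltk.
    rewrite !nth_traject //.
    apply: iter_chordless => //.
    - by move=> l; rewrite eqc' iter_next_mem.
    - by move=> l; rewrite /= next_cycle // iter_next_mem.
    - by move=> l; rewrite /= next_next_neq // iter_next_mem.
  have /eqP := congr1 (rotr j) eqt; rewrite rotK => /eqP <-.
  by rewrite /rotr rot_rot_add; eexists.
have xc : x \in c by rewrite eqcd.
case: (chordless_next gc chc xc _ (next_cycle Cd xd)).
- by rewrite eqcd mem_next.
- by move=> nx; have [i ->] := main c gc chc eqcd nx; exists i; left.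
have scr : same_cycle c (rev c) by exists 0; right; rewrite rot0.
have /and3P[_ Uc _] := gc.
move=> nx; have [||||i ->] := main (rev c); last by exists i; right.
- exact: (same_cycle_graph_cycle scr gc).
- move=> y z; rewrite !mem_rev => yc zc eyz.
  have /imsetP[w wc eqw] := chc _ _ yc zc eyz.
  apply/imsetP; exists (next c w); rewrite ?mem_rev ?mem_next //.
  by rewrite eqw next_rev // prev_next // setUC.
- by move=> y; rewrite mem_rev.
- by rewrite next_rev.
Qed.

End CyclicSequences.
(** * Faces and umbrellas of a simplicial surface *)

Section SurfaceGeometry.

Variables (P : finType) (X : {set {set P}}).
Hypothesis hX : simplicial_surface X.

Local Notation adj := (@face_adj P X).
Implicit Types (F G K : face X) (v w x y : P) (E : {set P}) (c d : seq (face X)).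

Lemma face_inX F : val F \in X.
Proof. by have := valP F; rewrite inE => /andP[]. Qed.

Lemma card_face F : #|val F| = 3.
Proof. by have := valP F; rewrite inE => /andP[_ /eqP]. Qed.

Lemma subface_edge F E : E \subset val F -> #|E| = 2 -> E \in simplices X 1.
Proof.
move=> sEF E2; have [[_ _ cl] _ _ _ _] := hX.
by rewrite inE E2 eqxx (cl E _ (face_inX F)).
Qed.

Lemma exists_face_above E : E \in X -> exists F, E \subset val F.
Proof.
have [_ mx _ _ _] := hX => EX.
have [A maxA sEA] := @maxset_exists _ [pred t | t \in X] E EX.
have A2 : A \in simplices X 2.
  by rewrite inE (mx A maxA) eqxx andbT; apply: (maxsetp maxA).
by exists (Sub A A2).
Qed.

Lemma face_exists : exists F : face X, True.
Proof.
have [[_ /set0Pn[E EX] _] _ _ _ _] := hX.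
by have [F _] := exists_face_above EX; exists F.
Qed.

Lemma verticesP v : reflect (exists F, v \in val F) (v \in vertices X).
Proof.
have [[_ _ cl] _ _ _ _] := hX.
rewrite !inE cards1 eqxx andbT; apply: (iffP idP) => [/exists_face_above[F]|[F vF]].
  by rewrite sub1set; exists F.
by rewrite (cl _ _ (face_inX F)) // sub1set.
Qed.

Lemma face_vertex F v : v \in val F -> v \in vertices X.
Proof. by move=> vF; apply/verticesP; exists F. Qed.

Lemma edge_face_pair F E : E \subset val F -> #|E| = 2 ->
  #|[set G : face X | E \subset val G]| = 2.
Proof.
move=> sEF E2; have [_ _ ed _ _] := hX.
rewrite -(card_imset _ val_inj); apply: etrans (ed E (subface_edge sEF E2)).
apply: eq_card => A; apply/imsetP/idP => [[G]|].
  by rewrite !inE => sEG ->; rewrite sEG andbT; have := valP G; rewrite inE.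
by rewrite inE => /andP[A2 sEA]; exists (Sub A A2); rewrite ?inE.
Qed.

(** A third face on [E] would contradict that an edge lies in exactly two faces. *)
Lemma edge_face_uniq F G K E : #|E| = 2 -> E \subset val F ->
  E \subset val G -> E \subset val K -> G != F -> K != F -> G = K.
Proof.
move=> E2 sEF sEG sEK nGF nKF; apply: contraTeq isT => nGK.
have: [set F; G; K] \subset [set H : face X | E \subset val H].
  by apply/subsetP=> H; rewrite !inE => /orP[/orP[]|] /eqP->.
move/subset_leq_card; rewrite (edge_face_pair sEF E2).
by rewrite setUC cardsU1 cards2 !inE (negPf nKF) eq_sym (negPf nGK) eq_sym nGF.
Qed.

Lemma face_eq F G : val F \subset val G -> F = G.
Proof. by move=> sFG; apply/val_inj/eqP; rewrite eqEcard sFG !card_face. Qed.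

(** Links adjacency by a common edge to the form used in [umbrella]. Distinct faces have three
    points each, so they cannot meet in more than two. *)
Lemma face_adjE F G : adj F G = (#|val F :&: val G| == 2).
Proof.
apply/andP/eqP => [[nFG /existsP[E /and3P[]]]|FG2].
  rewrite inE => /andP[_ /eqP E2] sEF sEG.
  have le2 : 1 < #|E| by rewrite E2.
  have lt3 : #|val F :&: val G| < #|val F|.
    apply: proper_card; rewrite properE subsetIl subsetI subxx /=.
    by apply: contra nFG => /face_eq ->.
  apply/eqP; rewrite eqn_leq -ltnS; move: lt3; rewrite (card_face F) => -> /=.
  by apply: leq_trans le2 _; rewrite subset_leq_card // subsetI sEF.
split; first by apply: contra_eq_neq FG2 => ->; rewrite setIid card_face.
apply/existsP; exists (val F :&: val G).
by rewrite (subface_edge (F := F)) ?subsetIl ?subsetIr.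
Qed.

Lemma face_adj_sym : symmetric adj.
Proof. by move=> F G; rewrite !face_adjE setIC. Qed.

Lemma face_adj_neq F G : adj F G -> G != F.
Proof. by case/andP; rewrite eq_sym. Qed.

Lemma adj_sub F G E : #|E| = 2 -> E \subset val F -> E \subset val G -> F != G ->
  val F :&: val G = E.
Proof.
move=> E2 sEF sEG nFG; apply/esym/eqP; rewrite eqEcard subsetI sEF sEG E2 /=.
suff: adj F G by rewrite face_adjE => /eqP ->.
by rewrite /face_adj nFG; apply/existsP; exists E; rewrite sEF sEG (subface_edge sEF).
Qed.

Lemma across_edge F E : E \subset val F -> #|E| = 2 ->
  exists2 G, adj F G & val F :&: val G = E.
Proof.
move=> sEF E2; have /eqP/cards2P[A [B [nAB /setP eqAB]]] := edge_face_pair sEF E2.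
have [G nGF sEG] : exists2 G, F != G & E \subset val G.
  have := eqAB F; rewrite !inE sEF => /esym/orP[]/eqP eqF.
    by exists B; rewrite ?eqF //; have := eqAB B; rewrite !inE eqxx orbT.
  by exists A; rewrite ?eqF 1?eq_sym //; have := eqAB A; rewrite !inE eqxx.
have eqE := adj_sub E2 sEF sEG nGF.
by exists G; rewrite // face_adjE eqE E2.
Qed.

Lemma across_vertex F x : x \in val F ->
  exists2 G, adj F G & val F :&: val G = val F :\ x.
Proof.
move=> xF; apply: across_edge; first exact: subD1set.
by have := cardsD1 x (val F); rewrite xF card_face => -[].
Qed.

Lemma face_third F v w : v \in val F -> w \in val F -> v != w ->
  exists x, [/\ x != v, x != w & val F = [set v; w; x]].
Proof.
move=> vF wF nvw; have := card_face F.
rewrite (cardsD1 v) vF (cardsD1 w) !inE eq_sym nvw wF => -[] /eqP/cards1P[x /setP eqx].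
have := eqx x; rewrite !inE eqxx => /and3P[xw xv xF]; exists x; split=> //.
apply/setP=> y; have := eqx y; rewrite !inE.
have [->|_] := eqVneq y w; first by rewrite wF orbT.
by have [->|_] := eqVneq y v; rewrite ?vF.
Qed.

Lemma face_other F v : v \in val F -> exists2 w, w \in val F & v != w.
Proof.
move=> vF; have: 0 < #|val F :\ v|.
  by move: (cardsD1 v (val F)); rewrite vF card_face; case: #|_ :\ _|.
by case/card_gt0P=> w; rewrite !inE eq_sym => /andP[nvw wF]; exists w.
Qed.

Lemma adj_card F G : adj F G -> #|val F :&: val G| = 2.
Proof. by rewrite face_adjE => /eqP. Qed.

Lemma adj_meet_inj F G K : adj F G -> adj F K ->
  val F :&: val G = val F :&: val K -> G = K.
Proof.
move=> FG FK eqGK; apply: (edge_face_uniq (adj_card FG) (F := F)).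
- exact: subsetIl.
- exact: subsetIr.
- rewrite eqGK; exact: subsetIr.
- exact: face_adj_neq FG.
- exact: face_adj_neq FK.
Qed.

(** Sending [G] to its intersection with [F] is a bijection from the neighbours of [F] to the
    2-subsets of [F], and there are three of these. *)
Lemma cubic_face_graph : cubic_graph adj.
Proof.
have [_ _ _ _ conn] := hX; split=> //; first by move=> F; rewrite /face_adj eqxx.
  exact: face_adj_sym.
move=> F; have inj : {in [set G | adj F G] &, injective (fun G => val F :&: val G)}.
  by move=> G K; rewrite !inE; apply: adj_meet_inj.
rewrite -(card_in_imset inj).
transitivity #|[set A : {set P} | A \subset val F & #|A| == 2]|; last first.
  by rewrite cards_draws card_face.
apply: eq_card => A; apply/imsetP/idP => [[G]|].
  by rewrite !inE => FG ->; rewrite subsetIl -face_adjE.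
rewrite inE => /andP[sAF /eqP A2]; have [G FG <-] := across_edge sAF A2.
by exists G; rewrite ?inE.
Qed.

(** * Umbrellas as chordless cycles of the face graph *)

Lemma vertex_separated v w : v \in vertices X -> v != w ->
  exists2 F : face X, v \in val F & w \notin val F.
Proof.
case/verticesP=> F vF nvw; have [wF|nwF] := boolP (w \in val F); last by exists F.
(* Crossing the edge of [F] opposite [w] keeps [v] and loses [w]. *)
have [G FG /setP eqG] := across_vertex wF.
have := eqG v; have := eqG w; rewrite !inE eqxx nvw vF wF /= => wG vG.
by exists G; rewrite ?wG.
Qed.

(** Restates [umbrella], which concerns sequences of sets, for cycles on the subtype [face]. The
    length bound inside [graph_cycle] is supplied by [vertex_face_cycle_size]. *)
Definition face_umbrella v c :=
  graph_cycle adj c /\ forall F, (F \in c) = (v \in val F).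

(** A face at [v] and its neighbours across its two edges at [v] are three distinct faces containing
    [v]. *)
Lemma vertex_face_cycle_size v c : v \in vertices X -> uniq c ->
  (forall F, (F \in c) = (v \in val F)) -> 2 < size c.
Proof.
case/verticesP=> F vF Uc eqc.
have [a aF nva] := face_other vF.
have [b [nbv nba eqF]] := face_third vF aF nva.
have bF : b \in val F by rewrite eqF !inE eqxx orbT.
have [G FG /setP eqG] := across_vertex aF.
have [K FK /setP eqK] := across_vertex bF.
have sub: {subset [:: F; G; K] <= c}.
  move=> H; rewrite !inE eqc => /or3P[]/eqP-> //.
    by have := eqG v; rewrite !inE nva vF.
  by have := eqK v; rewrite !inE (eq_sym v) nbv vF.
apply: (uniq_leq_size _ sub) => /=.
rewrite !inE negb_or !(eq_sym F) (face_adj_neq FG) (face_adj_neq FK) /= andbT.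
apply: contraNneq nba => eqGK; have := eqG b; rewrite eqGK.
have := eqK b; rewrite !inE bF eqxx => -> /=.
by case: (b == a).
Qed.

Lemma face_umbrellaP v c : v \in vertices X ->
  face_umbrella v c <-> umbrella X v [seq val F | F <- c].
Proof.
move=> vX; split=> [[/and3P[c2 Uc Cc] eqc]|[Uc eqc Cc]].
  split; first by rewrite map_inj_uniq //; apply: val_inj.
    move=> A; apply/mapP/andP => [[F Fc ->]|[A2 vA]].
      by rewrite (valP F) -eqc Fc.
    by exists (Sub A A2); rewrite ?eqc.
  by rewrite (mono_cycle (e := adj)) // => F G; rewrite face_adjE.
have eqc' F : (F \in c) = (v \in val F).
  by have := eqc (val F); rewrite (valP F) mem_map //; apply: val_inj.
have Uc' : uniq c by move: Uc; rewrite map_inj_uniq //; apply: val_inj.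
split=> //; rewrite /graph_cycle Uc' (vertex_face_cycle_size vX Uc' eqc') /=.
by move: Cc; rewrite (mono_cycle (e := adj)) // => F G; rewrite face_adjE.
Qed.

Lemma vertex_defining_cycleP c :
  vertex_defining_cycle c <-> exists2 v, v \in vertices X & face_umbrella v c.
Proof. by split=> -[v vX uc]; exists v => //; apply/(face_umbrellaP _ vX). Qed.

Lemma face_umbrella_exists v : v \in vertices X -> exists c, face_umbrella v c.
Proof.
move=> vX; have [_ _ _ um _] := hX; have [s us] := um v vX.
suff [c defs] : exists c : seq (face X), s = [seq val F | F <- c].
  by exists c; apply/(face_umbrellaP _ vX); rewrite -defs.
have: all (mem (simplices X 2)) s.
  by apply/allP=> A; case: us => _ -> _ /andP[].
elim: s {us} => [|A s IH] /=; first by exists [::].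
by case/andP=> A2 /IH[c ->]; exists (Sub A A2 :: c).
Qed.

(** A face has only two edges through [v], and these are already crossed by its successor and its
    predecessor in the umbrella. *)
Lemma face_umbrella_chordless v c : face_umbrella v c -> chordless adj c.
Proof.
move=> [/and3P[c2 Uc Cc] eqc] F G Fc Gc FG.
pose N := next c F; pose M := prev c F.
have FN : adj F N by apply: next_cycle.
have FM : adj F M by rewrite face_adj_sym; apply: prev_cycle.
have nNM : N != M by apply: next_neq_prev.
have [vF vG vN vM] : [/\ v \in val F, v \in val G, v \in val N & v \in val M].
  by split; rewrite -eqc ?mem_next ?mem_prev.
suff [->|->] : G = N \/ G = M.
- exact: next_arc Fc.
- exact: prev_arc Uc Fc.
clearbody N M.
have edge A : adj F A -> v \in val A -> exists y,
    [/\ y != v, y \in val F & val F :&: val A = [set v; y]].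
  rewrite face_adjE => FA vA.
  have := cardsD1 v (val F :&: val A); rewrite inE vF vA (eqP FA).
  case=> /esym/eqP/cards1P[y /setP eqy].
  have := eqy y; rewrite !inE eqxx => /and3P[yv yF yA]; exists y; split=> //.
  apply/setP=> z; have := eqy z; rewrite !inE.
  by have [->|] := eqVneq z v; rewrite ?vF ?vA.
have [g [gv gF eqg]] := edge _ FG vG.
have [n [nv nF eqn]] := edge _ FN vN.
have [m [mv mF eqm]] := edge _ FM vM.
have [gn|ngn] := eqVneq g n; first left.
  by apply: (adj_meet_inj FG FN); rewrite eqg gn.
have [gm|ngm] := eqVneq g m; first right.
  by apply: (adj_meet_inj FG FM); rewrite eqg gm.
have nmE : n != m.
  by apply: contra_neq nNM => eqnm; apply: (adj_meet_inj FN FM); rewrite eqn eqm eqnm.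
(* Otherwise [v] and the far ends of the three crossed edges would be four distinct points of
   [F]. *)
have: [:: v; g; n; m] \subset val F.
  by apply/subsetP=> z; rewrite !inE => /or4P[]/eqP->.
have /card_uniqP card4 : uniq [:: v; g; n; m].
  rewrite /= !inE !negb_or (eq_sym v g) (eq_sym v n) (eq_sym v m) gv nv mv.
  by rewrite ngn ngm nmE.
by move/subset_leq_card; rewrite card4 card_face.
Qed.

Lemma face_umbrella_unique v c d :
  face_umbrella v c -> face_umbrella v d -> same_cycle c d.
Proof.
move=> uc ud; apply: (chordless_same_cycle face_adj_sym (e := adj)).
- by case: uc.
- exact: face_umbrella_chordless uc.
- by case: ud.
- by move=> F; rewrite (proj2 uc) (proj2 ud).
Qed.

Lemma face_umbrella_same v c d :
  same_cycle c d -> face_umbrella v c -> face_umbrella v d.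
Proof.
move=> scd [gc eqc]; split; first exact: (same_cycle_graph_cycle face_adj_sym scd gc).
by move=> F; rewrite -(same_cycle_mem scd).
Qed.

Lemma face_umbrella_vertex v w c : v \in vertices X ->
  face_umbrella v c -> face_umbrella w c -> v = w.
Proof.
move=> vX [_ vc] [_ wc]; apply: contraTeq isT => nvw.
by have [F] := vertex_separated vX nvw; rewrite -vc wc => ->.
Qed.

(** If [F] and [G] share the edge with ends [v] and [w], the two cycles through their arc are the
    umbrellas of [v] and [w]; chordlessness puts the arc on both. *)
Lemma umbrellas_cdc : cycle_double_cover adj (@vertex_defining_cycle P X).
Proof.
split=> [c /vertex_defining_cycleP[v _ []]//|a /imsetP[[F G]]].
rewrite inE /= => FG ->.
have : #|val F :&: val G| == 2 by rewrite -face_adjE.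
case/cards2P=> v [w [nvw /setP eqE]].
have [vF vG] : v \in val F /\ v \in val G.
  by apply/andP; have := eqE v; rewrite !inE eqxx.
have [wF wG] : w \in val F /\ w \in val G.
  by apply/andP; have := eqE w; rewrite !inE eqxx orbT.
have vX := face_vertex vF; have wX := face_vertex wF.
have [c uc] := face_umbrella_exists vX; have [d ud] := face_umbrella_exists wX.
exists c, d; split.
- split; first by apply/vertex_defining_cycleP; exists v.
  by apply: (face_umbrella_chordless uc) FG; rewrite (proj2 uc).
- split; first by apply/vertex_defining_cycleP; exists w.
  by apply: (face_umbrella_chordless ud) FG; rewrite (proj2 ud).
- move=> /face_umbrella_same/(_ uc)/face_umbrella_vertex => /(_ w vX ud) eqvw.
  by rewrite eqvw eqxx in nvw.
move=> b /vertex_defining_cycleP[u uX ub] arcb.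
have : u \in [set v; w].
  rewrite -eqE inE -!(proj2 ub).
  by rewrite !(cycle_arcs_mem arcb) // !inE eqxx ?orbT.
rewrite !inE => /orP[]/eqP equ; [left|right]; rewrite equ in ub.
  exact: face_umbrella_unique uc ub.
exact: face_umbrella_unique ud ub.
Qed.

Lemma umbrellas_vertex_faithful : vertex_faithful adj (@vertex_defining_cycle P X).
Proof.
split=> [c /vertex_defining_cycleP[v _ /face_umbrella_chordless]//|c d].
case/vertex_defining_cycleP=> v vX uc /vertex_defining_cycleP[w wX ud] nscd.
have nvw : v != w.
  apply: contra_notN nscd => /eqP eqvw; rewrite -eqvw in ud.
  exact: face_umbrella_unique uc ud.
(* The only candidate for a common arc is the pair of faces containing both [v] and [w], so the
   bound 1 is read as the size of a singleton. *)
rewrite -(cards1 [set K : face X | [set v; w] \subset val K]).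
apply: subset_leq_card; apply/subsetP=> a /setIP[ac ad]; rewrite inE.
have sub : a \subset [set K : face X | [set v; w] \subset val K].
  apply/subsetP=> K Ka; rewrite inE; apply/subsetP=> x; rewrite !inE.
  case/orP=> /eqP->; rewrite -?(proj2 uc) -?(proj2 ud).
    exact: cycle_arcs_mem ac Ka.
  exact: cycle_arcs_mem ad Ka.
rewrite eqEcard sub /=; case/imsetP: ac => F Fc defa.
have sF : [set v; w] \subset val F.
  by have := subsetP sub F; rewrite inE; apply; rewrite defa !inE eqxx.
rewrite (edge_face_pair sF) ?cards2 ?nvw // defa cards2.
have [/and3P[c2 Uc Cc] _] := uc.
by rewrite eq_sym (face_adj_neq (next_cycle Cc Fc)).
Qed.

(** * Automorphisms *)

Local Notation Aut := (surface_aut X).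
Implicit Types g h : {perm P}.

(** If [g v] and [h v] differ, some face contains the first but not the second; its common preimage
    would contain [v] by [g] and avoid it by [h]. Points that are not vertices are fixed by both. *)
Lemma lambda_inj : {in Aut &, injective (lambda X)}.
Proof.
move=> g h gA hA eqgh; apply/permP=> v.
have [gon _] := surface_autP _ _ gA; have [hon _] := surface_autP _ _ hA.
have [vX|nvX] := boolP (v \in vertices X); last by rewrite !(out_perm gon, out_perm hon).
apply: contraTeq isT => ngh.
have gvX : g v \in vertices X by rewrite (perm_closed _ gon).
have [K gvK] := vertex_separated gvX ngh.
have [F defK] : exists F, K = lambda X g F by exists ((lambda X g)^-1 K); rewrite permKV.
have defK' : K = lambda X h F by rewrite defK eqgh.
case/negP; move: gvK; rewrite {1}defK defK' !lambdaE //.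
by rewrite !(mem_imset _ _ perm_inj).
Qed.

Lemma lambda_graph_aut g : g \in Aut -> lambda X g \in graph_aut adj.
Proof.
move=> gA; apply/graph_autP=> F G.
rewrite !face_adjE !lambdaE // -imsetI; last by move=> x y _ _; apply: perm_inj.
by rewrite card_imset //; apply: perm_inj.
Qed.

Lemma face_umbrella_map g v c : g \in Aut -> face_umbrella v c ->
  face_umbrella (g v) [seq lambda X g F | F <- c].
Proof.
move=> gA [/and3P[c2 Uc Cc] eqc]; split.
  rewrite /graph_cycle size_map c2 map_inj_uniq ?Uc /=; last exact: perm_inj.
  have /graph_autP gm := lambda_graph_aut gA.
  by rewrite (mono_cycle (e := adj)).
move=> F; rewrite -[F](permKV (lambda X g)) mem_map; last exact: perm_inj.
by rewrite eqc lambdaE // (mem_imset _ _ perm_inj).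
Qed.

(** Being fixed pointwise spreads to adjacent faces: the second face on the common edge is
    preserved, and its remaining vertex has nowhere else to go. Strong connectedness then reaches
    every vertex. *)
Lemma aut_rigid g F : g \in Aut -> {in val F, g =1 id} -> g = 1.
Proof.
move=> gA; have [gon _] := surface_autP _ _ gA; have [_ _ _ _ conn] := hX.
have step K G : adj K G -> {in val K, g =1 id} -> {in val G, g =1 id}.
  move=> KG gK x xG; have [xK|nxK] := boolP (x \in val K); first exact: gK.
  have fixset (A : {set P}) : A \subset val K -> g @: A = A.
    move=> sAK; rewrite -[RHS]imset_id; apply: eq_in_imset => y yA.
    by rewrite gK // (subsetP sAK).
  have eqG : lambda X g G = G.
    apply: (edge_face_uniq (adj_card KG) (F := K)).
    - exact: subsetIl.
    - by rewrite lambdaE // -(fixset _ (subsetIl (val K) (val G))) imsetS // subsetIr.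
    - exact: subsetIr.
    - have {1}-> : K = lambda X g K by apply/val_inj; rewrite lambdaE // fixset.
      by rewrite (inj_eq perm_inj) (face_adj_neq KG).
    - exact: face_adj_neq KG.
  have gxG : g x \in val G by rewrite -eqG lambdaE // (mem_imset _ _ perm_inj).
  have gxK : g x \notin val K.
    by rewrite -(fixset (val K)) // (mem_imset _ _ perm_inj).
  have: #|val G :\: val K| <= 1.
    have := cardsID (val K) (val G).
    by rewrite setIC (adj_card KG) card_face; case: #|_| => [|[]].
  by move/card_le1_eqP; apply; rewrite inE ?nxK ?gxK.
move=> gF; apply/permP=> x; rewrite perm1.
have [xX|] := boolP (x \in vertices X); last exact: (out_perm gon).
have /verticesP[G xG] := xX.
suff gG : {in val G, g =1 id} by apply: gG.
have /connectP[p pF ->] := conn F G; elim: p F pF gF {xG} => //= K p IH F.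
by case/andP=> FK pK gF; apply: IH pK _; apply: step FK gF.
Qed.

(** * Transitivity and face stabilisers *)

Lemma face_transitiveP : face_transitive X <->
  forall F G, exists2 g, g \in Aut & lambda X g F = G.
Proof.
split=> [tr F G|tr].
  have [g gA eqG] := atransP2 tr (valP F) (valP G).
  by exists g => //; apply/val_inj; rewrite lambdaE.
have [F _] := face_exists; apply/imsetP; exists (val F); first exact: valP.
apply/setP=> A; apply/idP/orbitP=> [A2|[g gA <-]].
  have [g gA eqA] := tr F (Sub A A2); exists g => //.
  by rewrite /= /setact -[RHS](congr1 val eqA) lambdaE.
by have [_ gX] := surface_autP _ _ gA; apply: gX; apply: valP.
Qed.

Lemma lambda_image_transitiveP :
  [transitive lambda_image X, on [set: face X] | 'P] <->
  forall F G, exists2 g, g \in Aut & lambda X g F = G.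
Proof.
split=> [tr F G|tr].
  have [s] := atransP2 tr (in_setT F) (in_setT G).
  by rewrite lambda_imageE => /imsetP[g gA ->] ->; exists g.
have [F _] := face_exists; apply/imsetP; exists F; first exact: in_setT.
apply/esym/setP=> G; rewrite in_setT; apply/orbitP.
have [g gA <-] := tr F G; exists (lambda X g) => //.
by rewrite lambda_imageE imset_f.
Qed.

Lemma card_lambda_image : #|lambda_image X| = #|Aut|.
Proof. by rewrite lambda_imageE card_in_imset //; apply: lambda_inj. Qed.

Lemma card_faces : #|face X| = #|simplices X 2|.
Proof. by rewrite card_sig; apply: eq_card. Qed.

Lemma card_face_stab F : face_transitive X ->
  #|Aut| = (#|'C_Aut[val F | 'P^*]| * #|face X|)%N.
Proof.
move=> tr; rewrite -(card_orbit_stab 'P^* (surface_aut_group X) (val F)).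
by rewrite (atransP tr _ (valP F)) card_faces mulnC.
Qed.

(** By rigidity, restriction to [F] embeds the stabiliser into the permutations of three points;
    since both have order 6, it is onto. *)
Lemma face_stab_full F x y x' y' : #|'C_Aut[val F | 'P^*]| = 6 ->
    x \in val F -> y \in val F -> x' \in val F -> y' \in val F ->
    x != y -> x' != y' ->
  exists g, [/\ g \in Aut, g @: val F = val F, g x = x' & g y = y'].
Proof.
rewrite astab1_set => C6 xF yF x'F y'F nxy nxy'.
set C := _ :&: _ in C6.
have stab g : g \in C -> [/\ g \in Aut, g \in 'N(val F | 'P) & g @: val F = val F].
  case/setIP=> gA gN; split=> //; apply/eqP.
  rewrite eqEcard (card_imset _ perm_inj) leqnn andbT.
  by apply/subsetP=> _ /imsetP[z zF ->]; rewrite (astabsP gN).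
pose r := restr_perm (val F).
have rE g z : g \in C -> z \in val F -> r g z = g z.
  by case/stab=> _ gN _ zF; apply: restr_permE.
have rinj : {in C &, injective r}.
  move=> g h gC hC eqr; have [gA _ _] := stab g gC; have [hA _ hF] := stab h hC.
  apply/eqP; rewrite eq_mulgV1; apply/eqP/(@aut_rigid _ F).
    by rewrite groupM ?groupV.
  by move=> z zF; rewrite permM -(rE g z) // eqr rE // permK.
have rC : r @: C = [set s | perm_on (val F) s].
  apply/eqP; rewrite eqEcard (card_in_imset rinj) C6 cardsE card_perm card_face /= andbT.
  by apply/subsetP=> _ /imsetP[g _ ->]; rewrite inE restr_perm_on.
(* The first transposition sends [x] to [x'] and [y] to [z]; the second takes [z] to [y'] and leaves
   [x'] in place. *)
pose z := tperm x x' y; pose s := (tperm x x' * tperm z y')%g.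
have zF : z \in val F by rewrite /z; case: tpermP.
have sF : s \in r @: C.
  rewrite rC inE; apply: perm_onM; apply/subsetP=> t; rewrite inE;
  by case: tpermP => [->|->|] //; rewrite eqxx.
have [g gC eqs] := imsetP sF; have [gA _ gF] := stab g gC.
have nzx : z != x'.
  by rewrite -(inj_eq (@perm_inj _ (tperm x x'))) tpermK tpermR eq_sym.
exists g; split; rewrite // -(rE g) // -eqs permM ?tpermL //.
by rewrite tpermD // eq_sym.
Qed.

(** Face-transitivity brings [F] to [G], and an element of the stabiliser of [G] then corrects the
    two points. *)
Lemma flag_transitive F G x y x' y' :
    face_transitive X -> #|'C_Aut[val G | 'P^*]| = 6 ->
    x \in val F -> y \in val F -> x' \in val G -> y' \in val G ->
    x != y -> x' != y' ->
  exists g, [/\ g \in Aut, lambda X g F = G, g x = x' & g y = y'].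
Proof.
move=> /face_transitiveP tr C6 xF yF x'G y'G nxy nxy'.
have [h hA eqG] := tr F G.
have hin z : z \in val F -> h z \in val G.
  by move=> zF; rewrite -eqG lambdaE // imset_f.
have [|g [gA gG gx gy]] := face_stab_full C6 (hin x xF) (hin y yF) x'G y'G _ nxy'.
  by rewrite (inj_eq perm_inj).
exists (h * g); rewrite groupM // !permM; split=> //.
apply/val_inj; rewrite lambdaE ?groupM // (eq_imset _ (permM h g)) imset_comp.
by rewrite -lambdaE // eqG.
Qed.

Lemma lambda_iter g i F : g \in Aut ->
  iter i (lambda X g) F = lambda X (g ^+ i) F.
Proof.
move=> gA; elim: i => [|i IH].
  apply/val_inj; rewrite /= expg0 lambdaE ?group1 // (eq_imset _ (@perm1 P)).
  by rewrite imset_id.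
apply/val_inj; rewrite iterS IH !lambdaE ?groupX // expgSr.
by rewrite -imset_comp (eq_imset _ (permM (g ^+ i) g)).
Qed.

(* [g] rotates the umbrella of [v] by one step; rigidity makes the order of
   [lambda X g] equal to the length of the umbrella. *)
Lemma alpha_rotation v c F a b g : face_umbrella v c -> F \in c ->
    val F :&: val (next c F) = [set v; b] -> val F = [set v; b; a] -> a != b ->
    g \in Aut -> g v = v -> g a = b -> lambda X g F = next c F ->
  alpha (lambda X g) [:: F; next c F] = traject (next c) (next c F) (size c).
Proof.
move=> uc Fc eqI eqF nab gA gv ga gF; set s := lambda X g.
have [gc eqc] := uc; have /and3P[c2 Uc Cc] := gc.
have /graph_autP sadj := lambda_graph_aut gA.
have gnv i : (g ^+ i) v = v by rewrite permX; elim: i => //= i ->.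
have smem i : iter i s F \in c.
  by rewrite lambda_iter // eqc lambdaE ?groupX // -(gnv i) (mem_imset _ _ perm_inj) -eqc.
have adjF := next_cycle Cc Fc.
have nvb : b != v.
  by apply/eqP=> bv; have := adj_card adjF; rewrite eqI bv setUid cards1.
have nav : a != v.
  apply/eqP=> av; have := card_face F.
  by rewrite eqF av setUAC setUid cards2; case: (v != b).
have sit : forall i, iter i s F = iter i (next c) F.
  apply: (iter_chordless gc (face_umbrella_chordless uc)) => //.
    by elim=> [|i IH]; [rewrite /= gF | rewrite !iterS sadj].
  (* By injectivity only the first step matters. Turning back there would swap [F] and its
     successor, so [g] would preserve their common edge; fixing [v], it would also fix [b], and
     [g a = b] would give [a = b]. *)
  elim=> [|i IH]; last by rewrite ![iter _.+1 _ _]iterS (inj_eq perm_inj).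
  rewrite /= gF; apply: contra_neq nab => eqF2.
  have gI : g @: [set v; b] = [set v; b].
    rewrite -eqI imsetI; last by move=> x y _ _; apply: perm_inj.
    by rewrite -!lambdaE // gF -/s eqF2 setIC.
  have : g b \in [set v; b] by rewrite -gI imset_f // !inE eqxx orbT.
  rewrite !inE -{1}gv -{3}ga !(inj_eq perm_inj) (negPf nvb).
  by move=> /eqP->.
(* This power preserves [F] and its successor and fixes [v]; hence it fixes [b], the other end of
   their common edge, then the third point [a], and rigidity applies. *)
have gn1 : g ^+ size c = 1.
  pose h := g ^+ size c.
  have hF : lambda X h F = F by rewrite -lambda_iter // sit iter_next_size.
  have hF2 : lambda X h (next c F) = next c F.
    by rewrite -lambda_iter // -gF -/s -iterSr iterS sit iter_next_size.
  have hE K x : lambda X h K = K -> (h x \in val K) = (x \in val K).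
    by move=> {1}<-; rewrite lambdaE ?groupX // (mem_imset _ _ perm_inj).
  have hv : h v = v by apply: gnv.
  have hb : h b = b.
    have : h b \in [set v; b] by rewrite -eqI inE !hE // -in_setI eqI !inE eqxx orbT.
    by rewrite !inE -{1}hv (inj_eq perm_inj) (negPf nvb) => /eqP.
  have ha : h a = a.
    have : h a \in [set v; b; a] by rewrite -eqF hE // eqF !inE eqxx orbT.
    by rewrite !inE -{1}hv -{1}hb !(inj_eq perm_inj) (negPf nab) (negPf nav) => /eqP.
  apply: (aut_rigid (F := F)); first exact: groupX.
  by move=> x; rewrite eqF !inE => /orP[/orP[]|] /eqP->.
have sn1 : s ^+ size c = 1.
  by apply/permP=> K; rewrite permX lambda_iter // gn1 -(expg0 g) -lambda_iter // perm1.
have ord_s : #[s] = size c.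
  apply/eqP; rewrite eqn_leq; apply/andP; split.
    by apply: dvdn_leq; [apply: leq_trans c2 | rewrite order_dvdn sn1].
  (* A smaller order would bring [F] back before the umbrella closes. *)
  rewrite leqNgt; apply/negP=> lts.
  have /(@iter_next_inj _ c F _ 0 Uc Fc lts) : iter #[s] (next c) F = iter 0 (next c) F.
    by rewrite -sit -permX expg_order perm1.
  by move=> /(_ (ltnW (ltnW c2)))/eqP; rewrite -leqn0 leqNgt order_gt0.
(* [alpha] lists the powers from 1 on, so the sequence starts at [next c F] and not at [F]. *)
have eqtr :
    [seq (s ^+ i) F | i <- iota 1 (size c)] = traject (next c) (next c F) (size c).
  apply: (@eq_from_nth _ (next c F)); rewrite size_map size_iota ?size_traject //.
  move=> i lti.
  by rewrite (nth_map 0) ?size_iota // nth_iota // nth_traject // permX sit -iterSr.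
rewrite /alpha /= ord_s; case: eqP => [_|].
  by rewrite -eqtr; elim: (iota _ _) => //= i l ->.
(* The empty-cycle branch is impossible: [Sigma] is the node set of [c]. *)
case; rewrite mul1n.
transitivity #|[set x in c]|; last by rewrite cardsE; apply/card_uniqP.
apply: eq_card => K; rewrite inE; apply/imset2P/idP => [[i H _]|Kc].
  by rewrite inE => /eqP-> ->; rewrite permX.
have [k defc] := traject_next Uc Fc.
move: Kc; rewrite -(mem_rot k) defc => /trajectP[i lti ->].
by exists (Ordinal lti) F; rewrite ?mem_head //= permX sit.
Qed.

(** With [b] the other end of the edge shared by [F] and its successor, and [a] the third point of
    [F], the rotation is the automorphism taking the flag of [F], [v], [a] to that of [next c F],
    [v], [b]. *)
Lemma rotation_exists v c F : face_transitive X ->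
    (forall G, #|'C_Aut[val G | 'P^*]| = 6) -> face_umbrella v c -> F \in c ->
  exists2 g, g \in Aut & lambda X g F = next c F /\
    alpha (lambda X g) [:: F; next c F] = traject (next c) (next c F) (size c).
Proof.
move=> tr C6 uc Fc; have [/and3P[c2 Uc Cc] eqc] := uc.
have adjF := next_cycle Cc Fc.
have vF : v \in val F by rewrite -eqc.
have vF2 : v \in val (next c F) by rewrite -eqc mem_next.
have [b [nvb eqI]] : exists b, v != b /\ val F :&: val (next c F) = [set v; b].
  have /eqP/cards2P[x [y [nxy eqI]]] := adj_card adjF.
  have : v \in [set x; y] by rewrite -eqI inE vF.
  by rewrite !inE => /orP[]/eqP->; [exists y | exists x; rewrite eq_sym setUC].
have [bF bF2] : b \in val F /\ b \in val (next c F).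
  by apply/setIP; rewrite eqI !inE eqxx orbT.
have [a [nav nab eqF]] := face_third vF bF nvb.
have aF : a \in val F by rewrite eqF !inE eqxx orbT.
have nva : v != a by rewrite eq_sym.
have [g [gA gF gv ga]] := flag_transitive tr (C6 _) vF aF vF2 bF2 nva nvb.
exists g => //; split=> //.
exact: (alpha_rotation uc Fc eqI eqF nab gA gv ga gF).
Qed.

(** * The two directions of the equivalence *)

Lemma umbrella_data16 : face_transitive X ->
    (forall G, #|'C_Aut[val G | 'P^*]| = 6) ->
  exists (s : {perm face X}) F1 F2,
    data16 adj (lambda_image X) s F1 F2 /\
    forall c, cover16 (lambda_image X) s F1 F2 c <-> vertex_defining_cycle c.
Proof.
move=> tr C6; have [F _] := face_exists.
have [v vF] : exists v, v \in val F by apply/card_gt0P; rewrite card_face.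
have vX := face_vertex vF; have [c uc] := face_umbrella_exists vX.
have Fc : F \in c by rewrite (proj2 uc).
have [/and3P[c2 Uc Cc] eqc] := uc.
have [g gA [gF alphaE]] := rotation_exists tr C6 uc Fc.
exists (lambda X g), F, (next c F).
have F2c : next c F \in c by rewrite mem_next.
have ual : face_umbrella v (alpha (lambda X g) [:: F; next c F]).
  have [i defc] := traject_next Uc F2c; apply: face_umbrella_same uc.
  by exists i; left; rewrite alphaE defc.
(* Automorphisms send umbrellas to umbrellas, and flag-transitivity moves [v] to any other vertex,
   so the orbit consists of all umbrellas. *)
have covE d : cover16 (lambda_image X) (lambda X g) F (next c F) d <->
    vertex_defining_cycle d.
  split=> [[t tH scd]|/vertex_defining_cycleP[w wX ud]].
    move: tH scd; rewrite lambda_imageE => /imsetP[h hA ->] scd.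
    apply/vertex_defining_cycleP; exists (h v).
      by have [hon _] := surface_autP _ _ hA; rewrite (perm_closed _ hon).
    exact: face_umbrella_same scd (face_umbrella_map hA ual).
  have /verticesP[G wG] := wX.
  have [x xF nvx] := face_other vF; have [y yG nwy] := face_other wG.
  have [h [hA _ hv _]] := flag_transitive tr (C6 _) vF xF wG yG nvx nwy.
  exists (lambda X h); first by rewrite lambda_imageE imset_f.
  apply: face_umbrella_unique ud; rewrite -hv.
  exact: face_umbrella_map hA ual.
split=> //; split=> //.
- exact: next_cycle.
- by rewrite lambda_imageE imset_f.
(* The two predicates on cycles are known to be equivalent, not equal, so the cover properties are
   transported clause by clause along [covE]. *)
- have [cyc cov] := umbrellas_cdc; split=> [d /covE|e /cov]; first exact: cyc.
  case=> d1 [d2 [[C1 e1] [C2 e2] n12 un]]; exists d1, d2; split=> //.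
  + by split=> //; apply/covE.
  + by split=> //; apply/covE.
  + by move=> d /covE; apply: un.
- have [ch vf] := umbrellas_vertex_faithful; split=> [d /covE|d1 d2 /covE C1 /covE].
    exact: ch.
  exact: vf.
Qed.

Lemma group16_of_vf16 : face_transitive X ->
    (forall G, #|'C_Aut[val G | 'P^*]| = 6) ->
  is_group16 adj (lambda_image X).
Proof.
move=> tr C6.
have sHA : lambda_image X \subset graph_aut adj.
  by rewrite lambda_imageE; apply/subsetP=> _ /imsetP[g gA ->]; apply: lambda_graph_aut.
have trH : [transitive lambda_image X, on [set: face X] | 'P].
  exact/lambda_image_transitiveP/face_transitiveP.
split=> //.
- split; first exact: cubic_face_graph.
  rewrite /node_transitive (atrans_supgroup sHA trH).
  by apply/subsetP=> t _; apply/astabsP=> G; rewrite !in_setT.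
- have [F _] := face_exists.
  by split=> //; rewrite card_lambda_image (card_face_stab F tr) C6.
have [s [F1 [F2 [D _]]]] := umbrella_data16 tr C6.
by exists s, F1, F2.
Qed.

Lemma vf16_of_group16 s F1 F2 : is_group16 adj (lambda_image X) ->
    data16 adj (lambda_image X) s F1 F2 ->
    (forall c, cover16 (lambda_image X) s F1 F2 c <-> vertex_defining_cycle c) ->
  face_transitive X /\ vf_is X 1 6.
Proof.
case=> _ _ [/lambda_image_transitiveP/face_transitiveP tr cardH] _ _ covE.
split=> //; split; last first.
  move=> A A2; have := card_face_stab (Sub A A2) tr.
  rewrite -card_lambda_image cardH => /eqP; rewrite eqn_pmul2r => [/eqP//|].
  by apply/card_gt0P; exists (Sub A A2).
(* The alpha-cycle lies in its own orbit, hence is the umbrella of some [v]. *)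
have /covE/vertex_defining_cycleP[v vX ual] :
    cover16 (lambda_image X) s F1 F2 (alpha s [:: F1; F2]).
  exists 1; first exact: group1.
  by exists 0; left; rewrite rot0 (eq_map (@perm1 _)) map_id.
(* An automorphism carrying the umbrella of [v] to that of [w] sends [v] to [w], because an umbrella
   determines its vertex. *)
suff orb w : w \in vertices X -> w \in orbit 'P Aut v.
  have -> : orbit 'P Aut @: vertices X = [set orbit 'P Aut v].
    apply/setP=> O; rewrite inE; apply/imsetP/eqP => [[w wX ->]|->]; last by exists v.
    by apply/eqP; rewrite orbit_eq_mem; apply: orb.
  exact: cards1.
move=> wX; have [d ud] := face_umbrella_exists wX.
have /covE[t] : vertex_defining_cycle d by apply/vertex_defining_cycleP; exists w.
rewrite lambda_imageE => /imsetP[g gA ->] scd.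
apply/orbitP; exists g => //=.
apply: face_umbrella_vertex (face_umbrella_same scd (face_umbrella_map gA ual)) ud.
by have [gon _] := surface_autP _ _ gA; rewrite (perm_closed _ gon).
Qed.

End SurfaceGeometry.

Theorem theorem4p11 (P : finType) (X : {set {set P}})
    (hX : simplicial_surface X) :
  (face_transitive X /\ vf_is X 1 6) <->
  (is_group16 (@face_adj P X) (lambda_image X) /\
   exists (sigma : {perm face X}) (F1 F2 : face X),
     data16 (@face_adj P X) (lambda_image X) sigma F1 F2 /\
     forall c : seq (face X),
       cover16 (lambda_image X) sigma F1 F2 c <-> vertex_defining_cycle c).
Proof.
split=> [[tr [_ C6]]|[H16 [s [F1 [F2 [D covE]]]]]]; last exact: vf16_of_group16 D covE.
have C6' (G : face X) : #|'C_(surface_aut X)[val G | 'P^*]| = 6 by apply/C6/valP.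
split; [exact: group16_of_vf16 | exact: umbrella_data16].
Qed.
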